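(* Let $G$ be a $\nu$-group. If the derived subgroup $G'$ is finite, then $G$ is central-by-finite.
   Context: Conventions: $x^y = y^{-1}xy$ and $[x,y] = x^{-1}y^{-1}xy$. For a group $H$, let $H^{\varphi}$ be an isomorphic copy of $H$ via $\varphi : h \mapsto h^{\varphi}$. The group $\nu(H)$ is defined by the presentation $$\nu(H) = \left\langle H \cup H^{\varphi} \mid [g,h^{\varphi}]^k = [g^k,(h^k)^{\varphi}] = [g,h^{\varphi}]^{k^{\varphi}},\ \forall g,h,k \in H \right\rangle,$$ where the relations of $H$ and of $H^{\varphi}$ are also understood to hold (i.e. $\nu(H)$ is the quotient of the free product $H * H^{\varphi}$ by the displayed relations). A group $G$ is called a $\nu$-group if there exists a group $H$ with finitely generated derived subgroup $H'$ such that $G$ is isomorphic to the derived subgroup $\nu(H)'$ of $\nu(H)$. A group is central-by-finite if it has a central subgroup of finite index (equivalently, its center has finite index). *)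

(* Defs.v *)
From HB Require Import structures.
From mathcomp Require Import all_boot all_classical.

Set Implicit Arguments.
Unset Strict Implicit.
Unset Printing Implicit Defensive.

Import Algebra.

Local Open Scope classical_set_scope.
Local Open Scope quotient_scope.
Local Open Scope group_scope.

(* MathComp's [groupType] is the (possibly infinite) group structure, with
   x ^ y = y^-1 * (x * y) and [~ x, y] = x^-1 * (y^-1 * (x * y)). *)

Section Subgroups.
Variable G : groupType.
Implicit Types (A Z : set G).

Definition subgroup A : Prop := group_closed [in A].

Definition gen A : set G := smallest subgroup A.

Definition derived : set G := gen [set [~ x, y] | x in setT & y in setT].

Definition fin_generated A : Prop := exists2 S : set G, finite_set S & A = gen S.

Definition left_coset A (x : G) : set G := [set x * z | z in A].

Definition finite_index A : Prop := finite_set (range (left_coset A)).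

Definition central A : Prop := forall z x, A z -> commute z x.

Definition central_by_finite : Prop :=
  exists Z, [/\ subgroup Z, central Z & finite_index Z].

End Subgroups.

Arguments derived : clear implicits.
Arguments central_by_finite : clear implicits.

(* The group <X | t = u for all t, u with R t u> is the set of formal group
   terms over X modulo the least congruence containing the group laws and R. *)

Inductive gterm (X : Type) : Type :=
| Gen of X
| One
| Mul of gterm X & gterm X
| Inv of gterm X.

Arguments One {X}.

HB.instance Definition _ X := gen_eqMixin (gterm X).
HB.instance Definition _ X := gen_choiceMixin (gterm X).

(* These carry no laws: they only make the notations *, ^-1, ^ and [~ , ]
   available on terms. *)
HB.instance Definition _ X := hasMul.Build (gterm X) (@Mul X).
HB.instance Definition _ X := hasOne.Build (gterm X) (@One X).
HB.instance Definition _ X := hasInv.Build (gterm X) (@Inv X).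

Section Presentation.
Variables (X : Type) (R : gterm X -> gterm X -> Prop).

Inductive gcongr : gterm X -> gterm X -> Prop :=
| gcongr_rel t u : R t u -> gcongr t u
| gcongr_refl t : gcongr t t
| gcongr_sym t u : gcongr t u -> gcongr u t
| gcongr_trans t u v : gcongr t u -> gcongr u v -> gcongr t v
| gcongr_mul t t' u u' : gcongr t t' -> gcongr u u' -> gcongr (t * u) (t' * u')
| gcongr_inv t t' : gcongr t t' -> gcongr t^-1 t'^-1
| gcongr_mulA t u v : gcongr (t * (u * v)) (t * u * v)
| gcongr_mul1 t : gcongr (1 * t) t
| gcongr_1mul t : gcongr (t * 1) t
| gcongr_mulV t : gcongr (t^-1 * t) 1
| gcongr_Vmul t : gcongr (t * t^-1) 1.

Definition gcongrb (t u : gterm X) : bool := `[< gcongr t u >].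

Lemma gcongrb_equiv : equiv_class_of gcongrb.
Proof.
split=> [t|t u|u t v]; first by apply/asboolP; exact: gcongr_refl.
- by apply/asboolP/asboolP; exact: gcongr_sym.
- by move=> /asboolP tu /asboolP uv; apply/asboolP; exact: gcongr_trans tu uv.
Qed.

Canonical gcongr_equiv := EquivRelPack gcongrb_equiv.

Definition presented : Type := {eq_quot gcongr_equiv}.

HB.instance Definition _ := Choice.on presented.
HB.instance Definition _ := Quotient.on presented.

Definition presented_pi (t : gterm X) : presented := \pi_presented t.

Lemma presented_piP t u : presented_pi t = presented_pi u <-> gcongr t u.
Proof. by split=> [/eqmodP/asboolP|tu] //; apply/eqmodP/asboolP. Qed.

Lemma presented_reprP t : gcongr (repr (presented_pi t)) t.
Proof. by apply/presented_piP; rewrite /presented_pi reprK. Qed.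

Definition presented_one : presented := presented_pi 1.
Definition presented_mul (x y : presented) : presented :=
  presented_pi (repr x * repr y).
Definition presented_inv (x : presented) : presented :=
  presented_pi (repr x)^-1.

Lemma presented_piM t u :
  presented_mul (presented_pi t) (presented_pi u) = presented_pi (t * u).
Proof. by apply/presented_piP; apply: gcongr_mul; exact: presented_reprP. Qed.

Lemma presented_piV t : presented_inv (presented_pi t) = presented_pi t^-1.
Proof. by apply/presented_piP; apply: gcongr_inv; exact: presented_reprP. Qed.

Lemma presented_piK x : presented_pi (repr x) = x.
Proof. exact: reprK. Qed.

Lemma presented_mulA : associative presented_mul.
Proof.
move=> x y z; rewrite -(presented_piK x) -(presented_piK y) -(presented_piK z).
by rewrite !presented_piM; apply/presented_piP; exact: gcongr_mulA.
Qed.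

Lemma presented_mul1 : left_id presented_one presented_mul.
Proof.
move=> x; rewrite -(presented_piK x) presented_piM.
by apply/presented_piP; exact: gcongr_mul1.
Qed.

Lemma presented_1mul : right_id presented_one presented_mul.
Proof.
move=> x; rewrite -(presented_piK x) presented_piM.
by apply/presented_piP; exact: gcongr_1mul.
Qed.

Lemma presented_mulV : left_inverse presented_one presented_inv presented_mul.
Proof.
move=> x; rewrite -(presented_piK x) presented_piV presented_piM.
by apply/presented_piP; exact: gcongr_mulV.
Qed.

Lemma presented_Vmul : right_inverse presented_one presented_inv presented_mul.
Proof.
move=> x; rewrite -(presented_piK x) presented_piV presented_piM.
by apply/presented_piP; exact: gcongr_Vmul.
Qed.

HB.instance Definition _ := isGroup.Build presented
  presented_mulA presented_mul1 presented_1mul presented_mulV presented_Vmul.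

End Presentation.

Section Nu.
Variable H : groupType.

(* The generators h and h^phi of nu(H), for h in H. *)
Definition nu_gen (h : H) : gterm (H + H) := Gen (inl h).
Definition nu_phi (h : H) : gterm (H + H) := Gen (inr h).

(* The multiplication tables of H and H^phi imply all their relations. *)
Inductive nu_rel : gterm (H + H) -> gterm (H + H) -> Prop :=
| nu_relM h k : nu_rel (nu_gen h * nu_gen k) (nu_gen (h * k))
| nu_relMphi h k : nu_rel (nu_phi h * nu_phi k) (nu_phi (h * k))
| nu_relJ g h k :
    nu_rel ([~ nu_gen g, nu_phi h] ^ nu_gen k)
           [~ nu_gen (g ^ k), nu_phi (h ^ k)]
| nu_relJphi g h k :
    nu_rel [~ nu_gen (g ^ k), nu_phi (h ^ k)]
           ([~ nu_gen g, nu_phi h] ^ nu_phi k).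

End Nu.

Definition nu (H : groupType) : groupType := presented (@nu_rel H).

Definition is_nu_group (G : groupType) : Prop :=
  exists H : groupType, fin_generated (derived H) /\
    exists f : {multiplicative G -> nu H}, set_bij setT (derived (nu H)) f.

(* Main.v *)
Require Import Defs.
From mathcomp Require Import all_boot all_classical.

(** The nu-group G is identified with nu(H)'.  The generators of nu(H) define
    a homomorphism to H * H * H,

      theta : h |-> (h, h, 1),   h^phi |-> (h, 1, h),

    whose first coordinate folds the two copies of H together and whose last
    two coordinates separate them.  Two facts about theta give the theorem.

    - Its kernel is central ([ker_theta_central]).  An element killed by the
      last two coordinates lies in the subgroup T generated by the commutators
      [g, h^phi] ([nu_decomposition]), and an element t of T acts by conjugation
      in the way prescribed by its first coordinate r: T itself and every
      k^phi are conjugated by t as they are by r, seen in the first copy of H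
      ([conj_tensor_fold], [conj_phi_tensor]).  If r = 1 the action is
      trivial.

    - It maps nu(H)' onto H' * H' * H' ([theta_derived], [derived_theta]), a
      finitely generated group because H' is one.

    Hence G is finitely generated modulo its center, although G itself need
    not be finitely generated.  When G' is finite each element has only
    finitely many conjugates, so the center, being the common centralizer of
    finitely many lifts of generators, has finite index
    ([fg_mod_center_central_by_finite]). *)

Set Implicit Arguments.
Unset Strict Implicit.
Unset Printing Implicit Defensive.

Import Algebra.

Local Open Scope classical_set_scope.
Local Open Scope group_scope.

(** * Subgroups and homomorphisms *)

Section Subgroups.
Variable G : groupType.
Implicit Types A S : set G.

Lemma subgroupP A :
  subgroup A <-> A 1 /\ forall x y, A x -> A y -> A (x / y).
Proof.
split=> [[/set_mem A1 AF]|[A1 AF]]; split=> //.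
- by move=> x y Ax Ay; apply/set_mem/AF; exact: mem_set.
- exact: mem_set.
- by move=> x y /set_mem Ax /set_mem Ay; apply/mem_set/AF.
Qed.

Lemma subgroup_of A : A 1 -> (forall x y, A x -> A y -> A (x * y)) ->
  (forall x, A x -> A x^-1) -> subgroup A.
Proof. by move=> A1 AM AV; apply/subgroupP; split=> // x y Ax /AV; exact: AM. Qed.

Lemma subgroup1 A : subgroup A -> A 1.
Proof. by move=> /subgroupP[]. Qed.

Lemma subgroupV A x : subgroup A -> A x -> A x^-1.
Proof. by move=> /subgroupP[A1 AF] Ax; rewrite -div1g; exact: AF. Qed.

Lemma subgroupM A x y : subgroup A -> A x -> A y -> A (x * y).
Proof.
move=> sA Ax /(subgroupV sA) Ay; rewrite -[y]invgK.
by case/subgroupP: sA => _; apply.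
Qed.

Lemma gen_subgroup S : subgroup (gen S).
Proof.
apply/subgroupP; split=> [B [sB _]|x y Sx Sy B [sB SB]]; first exact: subgroup1.
by case/subgroupP: (sB) => _; apply; [apply: Sx|apply: Sy].
Qed.

Lemma gen_min S A : subgroup A -> S `<=` A -> gen S `<=` A.
Proof. exact: smallest_sub. Qed.

Lemma mem_gen S x : S x -> gen S x.
Proof. exact: sub_gen_smallest. Qed.

Lemma commutator_derived (x y : G) : derived G [~ x, y].
Proof. by apply: mem_gen; exists x => //; exists y. Qed.

Lemma derived_min A :
  subgroup A -> (forall x y, A [~ x, y]) -> derived G `<=` A.
Proof. by move=> sA AR; apply: gen_min => // _ [x _ [y _ <-]]. Qed.

Definition center : set G := [set z | forall x, commute z x].

Lemma center_subgroup : subgroup center.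
Proof.
apply: subgroup_of => [x|y z cy cz x|y cy x]; apply: commute_sym.
- exact: commute1.
- by apply: commuteM; apply: commute_sym.
- exact/commuteV/commute_sym.
Qed.

End Subgroups.

Section Morphisms.
Variables (G K : groupType) (f : G -> K).
Hypothesis fM : {morph f : x y / x * y}.

Lemma morph_1 : f 1 = 1.
Proof. by apply: (mulgI (f 1)); rewrite -fM !mulg1. Qed.

Lemma morph_V : {morph f : x / x^-1}.
Proof. by move=> x; apply/esym/mulg1_eq; rewrite -fM mulgV morph_1. Qed.

Lemma morph_J : {morph f : x y / x ^ y}.
Proof. by move=> x y; rewrite !conjgE !fM morph_V. Qed.

Lemma morph_R : {morph f : x y / [~ x, y]}.
Proof. by move=> x y; rewrite !commgEl fM morph_V morph_J. Qed.

Lemma preimage_subgroup (A : set K) : subgroup A -> subgroup (f @^-1` A).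
Proof.
move=> sA; apply: subgroup_of => [|x y|x] /=.
- by rewrite morph_1; exact: subgroup1.
- by rewrite fM; exact: subgroupM.
- by rewrite morph_V; exact: subgroupV.
Qed.

Lemma image_subgroup (A : set G) : subgroup A -> subgroup (f @` A).
Proof.
move=> sA; apply: subgroup_of => [|_ _ [x Ax <-] [y Ay <-]|_ [x Ax <-]].
- by exists 1; [exact: subgroup1|exact: morph_1].
- by exists (x * y); [exact: subgroupM|exact: fM].
- by exists x^-1; [exact: subgroupV|exact: morph_V].
Qed.

End Morphisms.

Lemma mul3E (H : groupType) (u v : (H * H * H)%type) :
  u * v = (u.1.1 * v.1.1, u.1.2 * v.1.2, u.2 * v.2).
Proof. by []. Qed.

Lemma inv3E (H : groupType) (u : (H * H * H)%type) :
  u^-1 = (u.1.1^-1, u.1.2^-1, u.2^-1).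
Proof. by []. Qed.

(** * Groups with finite derived subgroup *)

Lemma finite_range_factor (T U V : Type) (f : T -> U) (g : T -> V) :
  (forall x y, f x = f y -> g x = g y) -> finite_set (range f) ->
  finite_set (range g).
Proof.
move=> fg finf; case: (pselect (exists x : T, True)) => [[x0 _]|noT]; last first.
  by rewrite (_ : range g = set0) ?eqEsubset//; split=> // v [x]; case: noT; exists x.
have /choice[s sP] u : exists x, range f u -> f x = u.
  have [[x _ <-]|nu] := pselect (range f u); first by exists x.
  by exists x0.
apply: (@sub_finite_set _ _ ((g \o s) @` range f)); last exact: finite_image.
by move=> _ [x _ <-]; exists (f x); [exists x|apply/fg/sP; exists x].
Qed.

(** The coset of x modulo the common centralizer of a finite set X is
    determined by the commutators [s, x^-1] for s in X: finitely many elements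
    of the finite set G'. *)
Lemma finite_index_center (G : groupType) (X : set G) :
  finite_set X -> (forall y, (forall s, X s -> commute y s) -> center y) ->
  finite_set (derived G) -> finite_index (@center G).
Proof.
move=> /finite_seqP[xs ->] Xcent /finite_seqP[ds Dds].
(* The value is never None; the option only gives F a finite codomain. *)
pose F x : {ffun seq_sub xs -> option (seq_sub ds)} :=
  [ffun s => insub [~ val s, x^-1]].
apply: (@finite_range_factor _ _ _ F); last exact: finite_finset.
move=> x y Fxy; have xyZ : center (x^-1 * y).
  apply: Xcent => s xs_s; apply: commute_sym.
  have inds z : [~ s, z] \in ds.
    by have := commutator_derived s z; rewrite Dds.
  have /ffunP/(_ (SeqSub xs_s)) := Fxy; rewrite !ffunE /=.
  rewrite !(insubT (fun z => z \in ds) (inds _)) => -[]; rewrite !commgEl => /mulgI sxy.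
  by apply/commgP/conjg_fixP; rewrite conjgM sxy conjgKV.
have cs := center_subgroup G.
apply/seteqP; split=> _ [z cz <-].
  exists (y^-1 * x * z); last by rewrite !mulgA mulgV mul1g.
  apply: (subgroupM cs) => //; rewrite -[y^-1 * x]invgK invgM invgK.
  exact: (subgroupV cs).
by exists (x^-1 * y * z); [exact: (subgroupM cs)|rewrite !mulgA mulgV mul1g].
Qed.

(** If y commutes with lifts of the generators S, then its centralizer maps onto
    the range of th and contains the central kernel, so y is central. *)
Lemma fg_mod_center_central_by_finite (G K : groupType) (th : G -> K)
    (S : set K) : {morph th : x y / x * y} ->
  (forall x, th x = 1 -> center x) -> finite_set S ->
  S `<=` range th -> range th `<=` gen S ->
  finite_set (derived G) -> central_by_finite G.
Proof.
move=> thM kerZ finS Sth thS finG'; exists (@center G); split.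
- exact: center_subgroup.
- by move=> z x; apply.
pose lift k := xget 1 [set x | th x = k].
have liftK s : S s -> th (lift s) = s.
  by move=> /Sth[x _ thx]; exact: (@xgetI _ 1 [set x | th x = s] x).
apply: (@finite_index_center _ (lift @` S)) => //; first exact: finite_image.
move=> y cy x.
have cent_y : subgroup [set t : G | commute y t].
  apply: subgroup_of => [|t u|t] /=; first exact: commute1.
    exact: commuteM.
  exact: commuteV.
have [t yt tht] : (th @` [set t | commute y t]) (th x).
  apply: (@gen_min _ S); last by apply: thS; exists x.
    exact: image_subgroup.
  by move=> s Ss; exists (lift s); [apply: cy; exists s|exact: liftK].
have cz : center (t^-1 * x) by apply: kerZ; rewrite thM morph_V// tht mulVg.
rewrite -[x](mulVKg t); apply: commuteM => //.
by apply: commute_sym; apply: cz.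
Qed.

(** * Groups given by generators and relations *)

Section PresentedMorphism.
Variables (X : Type) (R : gterm X -> gterm X -> Prop) (K : groupType).
Variable e : X -> K.

Fixpoint eval (t : gterm X) : K :=
  match t with
  | Defs.Gen x => e x
  | Defs.One => 1
  | Defs.Mul t u => eval t * eval u
  | Defs.Inv t => (eval t)^-1
  end.

Hypothesis evalR : forall t u, R t u -> eval t = eval u.

Lemma eval_gcongr t u : gcongr R t u -> eval t = eval u.
Proof.
elim=> //= {t u}.
- by move=> t u v _ -> _ ->.
- by move=> t t' u u' _ -> _ ->.
- by move=> t t' _ ->.
- by move=> t u v; rewrite mulgA.
- by move=> t; rewrite mul1g.
- by move=> t; rewrite mulg1.
- by move=> t; rewrite mulVg.
- by move=> t; rewrite mulgV.
Qed.

Definition presented_lift (x : presented R) : K := eval (repr x).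

Lemma presented_lift_pi t : presented_lift (presented_pi R t) = eval t.
Proof. exact/eval_gcongr/presented_reprP. Qed.

Lemma presented_liftM : {morph presented_lift : x y / x * y}.
Proof. by move=> x y; rewrite [LHS]presented_lift_pi. Qed.

End PresentedMorphism.

(** * The two copies of H in nu(H) *)

Section NuStructure.
Variable H : groupType.
Implicit Types (g h k : H) (x y t : nu H).

Definition iota h : nu H := presented_pi _ (nu_gen h).
Definition phi h : nu H := presented_pi _ (nu_phi h).

Let piM (t u : gterm (H + H)) : presented_pi (@nu_rel H) (t * u) =
  presented_pi (@nu_rel H) t * presented_pi (@nu_rel H) u.
Proof. by rewrite -presented_piM. Qed.

Let piV (t : gterm (H + H)) : presented_pi (@nu_rel H) t^-1 =
  (presented_pi (@nu_rel H) t)^-1.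
Proof. by rewrite -presented_piV. Qed.

Lemma iotaM : {morph iota : h k / h * k}.
Proof.
by move=> h k; rewrite -[RHS]piM; apply/esym/presented_piP/gcongr_rel; constructor.
Qed.

Lemma phiM : {morph phi : h k / h * k}.
Proof.
by move=> h k; rewrite -[RHS]piM; apply/esym/presented_piP/gcongr_rel; constructor.
Qed.

Lemma conj_commutator_iota g h k :
  [~ iota g, phi h] ^ iota k = [~ iota (g ^ k), phi (h ^ k)].
Proof.
have /gcongr_rel/presented_piP := nu_relJ g h k.
by rewrite !(piM, piV).
Qed.

Lemma conj_commutator_phi g h k :
  [~ iota g, phi h] ^ phi k = [~ iota (g ^ k), phi (h ^ k)].
Proof.
have /gcongr_rel/presented_piP := nu_relJphi g h k.
by rewrite !(piM, piV).
Qed.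

Let iota1 : iota 1 = 1 := morph_1 iotaM.
Let phi1 : phi 1 = 1 := morph_1 phiM.

(** Each inverse of a generator is again a generator, so nu(H) is generated by
    the two copies of H as a monoid. *)
Lemma nu_ind (P : nu H -> Prop) : (forall h, P (iota h)) ->
  (forall h, P (phi h)) -> (forall x y, P x -> P y -> P (x * y)) ->
  forall x, P x.
Proof.
move=> Pi Pp PM x; rewrite -(presented_piK x).
suff [] : P (presented_pi _ (repr x)) /\ P (presented_pi _ (repr x))^-1 by [].
elim: (repr x) => [[h|h]||t [Pt PtV] u [Pu PuV]|t [Pt PtV]].
- by split; [exact: Pi|rewrite -(morph_V iotaM); exact: Pi].
- by split; [exact: Pp|rewrite -(morph_V phiM); exact: Pp].
- by rewrite -[presented_pi _ _]/(1 : nu H) invg1 -iota1.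
- rewrite -[Defs.Mul t u]/(t * u) piM invgM.
  by split; exact: PM.
- by rewrite -[Defs.Inv t]/(t^-1) piV invgK.
Qed.

(** * The homomorphism theta *)

Definition theta_gen (a : H + H) : (H * H * H)%type :=
  match a with inl h => (h, h, 1) | inr h => (h, 1, h) end.

Let theta_gen_rel (t u : gterm (H + H)) :
  nu_rel t u -> eval theta_gen t = eval theta_gen u.
Proof.
case=> [h k|h k|g h k|g h k] /=; rewrite !(mul3E, inv3E) /=;
  congr (_, _, _); rewrite ?mulg1 ?invg1 ?mul1g ?mulVg ?mul1g ?mulVg //.
- exact: (conjRg g h k).
- exact/esym/(conjRg g h k).
Qed.

Definition theta : nu H -> H * H * H := presented_lift theta_gen.

Lemma thetaM : {morph theta : x y / x * y}.
Proof. exact/presented_liftM/theta_gen_rel. Qed.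

Lemma theta_iota h : theta (iota h) = (h, h, 1).
Proof. by rewrite /theta presented_lift_pi //; exact: theta_gen_rel. Qed.

Lemma theta_phi h : theta (phi h) = (h, 1, h).
Proof. by rewrite /theta presented_lift_pi //; exact: theta_gen_rel. Qed.

Definition fold x : H := (theta x).1.1.

Lemma foldM : {morph fold : x y / x * y}.
Proof. by move=> x y; rewrite /fold thetaM. Qed.

Lemma fold_iota h : fold (iota h) = h.
Proof. by rewrite /fold theta_iota. Qed.

Lemma fold_phi h : fold (phi h) = h.
Proof. by rewrite /fold theta_phi. Qed.

(** * The subgroup generated by the mixed commutators *)

(** This subgroup of nu(H) is the nonabelian tensor square of H, whence the
    name. *)
Definition tensor : set (nu H) :=
  gen [set [~ iota g, phi h] | g in setT & h in setT].

Lemma tensor_subgroup : subgroup tensor.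
Proof. exact: gen_subgroup. Qed.

Lemma commutator_tensor g h : tensor [~ iota g, phi h].
Proof. by apply: mem_gen; exists g => //; exists h. Qed.

Lemma commutator_tensorV h g : tensor [~ phi h, iota g].
Proof.
rewrite -invgR; exact: (subgroupV tensor_subgroup (commutator_tensor _ _)).
Qed.

Lemma tensor_min (A : set (nu H)) : subgroup A ->
  (forall g h, A [~ iota g, phi h]) -> tensor `<=` A.
Proof. by move=> sA AR; apply: gen_min => // _ [g _ [h _ <-]]. Qed.

Let conjg_morph x : {morph (fun t => t ^ x) : t u / t * u}.
Proof. by move=> t u; rewrite conjMg. Qed.

Lemma tensorJ t x : tensor t -> tensor (t ^ x).
Proof.
elim/nu_ind: x t => [k|k|x y IHx IHy] t Tt; last first.
  by rewrite conjgM; exact: (IHy _ (IHx _ Tt)).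
- apply: (tensor_min (preimage_subgroup (conjg_morph (phi k)) tensor_subgroup)) Tt.
  by move=> g h /=; rewrite conj_commutator_phi; exact: commutator_tensor.
- apply: (tensor_min (preimage_subgroup (conjg_morph (iota k)) tensor_subgroup)) Tt.
  by move=> g h /=; rewrite conj_commutator_iota; exact: commutator_tensor.
Qed.

(** The defining relations say that k and k^phi conjugate the mixed
    commutators in the same way. *)
Lemma conj_tensor_fold t x : tensor t -> t ^ x = t ^ iota (fold x).
Proof.
elim/nu_ind: x t => [k|k|x y IHx IHy] t Tt.
- by rewrite fold_iota.
- rewrite fold_phi.
  suff : tensor `<=` [set u | u ^ phi k = u ^ iota k] by apply.
  apply: tensor_min => [|g h /=].
    apply: subgroup_of => [|u v|u] /=; first by rewrite !conj1g.
      by rewrite !conjMg => -> ->.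
    by rewrite !conjVg => ->.
  by rewrite conj_commutator_phi conj_commutator_iota.
- by rewrite foldM iotaM !conjgM IHx// IHy//; exact: tensorJ.
Qed.

(** * Centrality of the kernel of theta *)

(** The relations rearranged: (k^phi)^g = k^phi [k^phi, g], and h^phi sends
    [k^phi, g] to [(k^h)^phi, g^h]. *)
Lemma conj_phi_iota_phi k g h :
  (phi k ^ iota g) ^ phi h = phi (k ^ h) ^ iota (g ^ h).
Proof.
have phiE a b : phi a ^ iota b = phi a * [~ iota b, phi a]^-1.
  by rewrite invgR mulVKg.
by rewrite phiE conjMg conjVg conj_commutator_phi -(morph_J phiM) -phiE.
Qed.

(** The elements x acting on the conjugates of H^phi by the first copy of H in
    the way fold x does.  Allowing these conjugates, and not only H^phi, makes
    this set visibly closed under products and inverses. *)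
Definition acts_as_fold : set (nu H) := [set x | forall k a,
  (phi k ^ iota a) ^ x = (phi k ^ iota a) ^ iota (fold x)].

Lemma acts_as_fold_subgroup : subgroup acts_as_fold.
Proof.
have conjM k a b : (phi k ^ iota a) ^ iota b = phi k ^ iota (a * b).
  by rewrite iotaM conjgM.
apply: subgroup_of => [k a|x y Ax Ay k a|x Ax k a].
- by rewrite (morph_1 foldM) iota1 !conjg1.
- by rewrite conjgM Ax foldM !conjM Ay conjM mulgA.
- apply: (conjg_inj x); rewrite conjgKV (morph_V foldM).
  by rewrite conjM Ax conjM mulgVK.
Qed.

(** On T the element x already acts as fold x, so only the conjugation of
    k^phi has to be compared. *)
Lemma acts_as_foldP x :
  (forall k, phi k ^ x = phi k ^ iota (fold x)) -> acts_as_fold x.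
Proof.
move=> Px k a; rewrite (_ : phi k ^ iota a = phi k * [~ phi k, iota a]).
  rewrite [LHS]conjMg [RHS]conjMg Px; congr (_ * _).
  exact: (conj_tensor_fold _ (commutator_tensorV _ _)).
by rewrite mulVKg.
Qed.

Lemma conj_phi_tensor t k : tensor t -> phi k ^ t = phi k ^ iota (fold t).
Proof.
have iotaA g : acts_as_fold (iota g) by move=> l a; rewrite fold_iota.
have sA := acts_as_fold_subgroup.
suff /[apply]/(_ k 1) : tensor `<=` acts_as_fold by rewrite iota1 !conjg1.
apply: tensor_min => // g h; rewrite commgEl; apply: (subgroupM sA).
  exact: (subgroupV sA).
apply: acts_as_foldP => l; rewrite (morph_J foldM) fold_iota fold_phi.
(* Write l = m ^ h, so that the conjugation by (g ^ h^phi) is the conjugate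
   under h^phi of the conjugation of m^phi by g. *)
rewrite -[l](conjgKV h); set m := l ^ h^-1.
by rewrite {1}(morph_J phiM) -conjJg conj_phi_iota_phi.
Qed.

(** Such a t fixes every k^phi; as k conjugates t in the same way as k^phi, it
    commutes with k too. *)
Lemma tensor_ker_fold_central t : tensor t -> fold t = 1 -> center t.
Proof.
move=> Tt ft1.
have cphi k : commute t (phi k).
  apply/commute_sym/commgP/conjg_fixP.
  by rewrite conj_phi_tensor// ft1 iota1 conjg1.
elim/nu_ind => [k|//|x y]; last exact: commuteM.
apply/commgP/conjg_fixP; rewrite -[k]fold_phi -conj_tensor_fold//.
exact/conjg_fixP/commgP/cphi.
Qed.

(** Modulo the normal subgroup T the two copies of H commute, so every product
    of generators can be sorted. *)
Lemma nu_decomposition x :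
  exists2 t, tensor t & x = iota (theta x).1.2 * phi (theta x).2 * t.
Proof.
elim/nu_ind: x => [h|h|x y [t Tt xE] [u Tu yE]].
- exists 1; first exact: (subgroup1 tensor_subgroup).
  by rewrite theta_iota /= phi1 !mulg1.
- exists 1; first exact: (subgroup1 tensor_subgroup).
  by rewrite theta_phi /= iota1 mulg1 mul1g.
rewrite thetaM /= iotaM phiM.
move: (theta x).1.2 (theta x).2 (theta y).1.2 (theta y).2 xE yE.
move=> a b c d -> ->.
exists ([~ phi b, iota c] ^ phi d * (t ^ (iota c * phi d) * u)).
  apply: (subgroupM tensor_subgroup); first exact: (tensorJ _ (commutator_tensorV _ _)).
  by apply: (subgroupM tensor_subgroup) => //; exact: tensorJ.
by rewrite !commgEl !conjgE !gnorm.
Qed.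

Lemma ker_theta_central x : theta x = 1 -> center x.
Proof.
move=> thx1; have [t Tt] := nu_decomposition x.
rewrite thx1 /= iota1 phi1 !mul1g => xt.
by rewrite xt; apply: tensor_ker_fold_central => //; rewrite -xt /fold thx1.
Qed.

(** * The image of the derived subgroup under theta *)

Lemma theta_derived x : derived (nu H) x ->
  [/\ derived H (theta x).1.1, derived H (theta x).1.2 & derived H (theta x).2].
Proof.
have sD : subgroup (derived H) := gen_subgroup _.
pose D := [set u : H * H * H |
  [/\ derived H u.1.1, derived H u.1.2 & derived H u.2]].
suff : derived (nu H) `<=` theta @^-1` D by apply.
apply: derived_min => [|y z].
  apply: (preimage_subgroup thetaM); apply: subgroup_of.
  - by split; exact: (subgroup1 sD).
  - by move=> u v [u1 u2 u3] [v1 v2 v3]; split; exact: (subgroupM sD).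
  - by move=> u [u1 u2 u3]; split; exact: (subgroupV sD).
by rewrite /D /= (morph_R thetaM); split; exact: commutator_derived.
Qed.

Let D3 := theta @` derived (nu H).

Let D3_subgroup : subgroup D3.
Proof. exact/(image_subgroup thetaM)/gen_subgroup. Qed.

(** The elements that a homomorphism e sends into the subgroup theta(nu(H)')
    form a subgroup of H, so H' is among them as soon as its generators are. *)
Let D3_min (e : H -> H * H * H) : {morph e : x y / x * y} ->
  (forall g h, exists x y, theta [~ x, y] = e [~ g, h]) ->
  forall s, derived H s -> D3 (e s).
Proof.
move=> eM eR; apply: (derived_min (preimage_subgroup eM D3_subgroup)) => g h.
by have [x [y xy]] := eR g h; exists [~ x, y] => //; exact: commutator_derived.
Qed.

(** The three coordinate copies of H' come from [g, h^phi] |-> ([g, h], 1, 1)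
    and from the derived subgroups of the two copies of H. *)
Lemma derived_theta s : derived H s ->
  [/\ D3 (s, 1, 1), D3 (1, s, 1) & D3 (1, 1, s)].
Proof.
have e1M : {morph (fun s : H => (s, 1, 1) : H * H * H) : x y / x * y}.
  by move=> x y; congr (_, _, _); rewrite mulg1.
have e2M : {morph (fun s : H => (s, s, 1) : H * H * H) : x y / x * y}.
  by move=> x y; congr (_, _, _); rewrite mulg1.
have e3M : {morph (fun s : H => (s, 1, s) : H * H * H) : x y / x * y}.
  by move=> x y; congr (_, _, _); rewrite mulg1.
move=> Ds.
have D1 : D3 (s, 1, 1).
  apply: (D3_min e1M) Ds => g h; exists (iota g), (phi h).
  rewrite (morph_R thetaM) theta_iota theta_phi.
  by congr (_, _, _); [exact: commg1|exact: comm1g].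
have D2 : D3 (s, s, 1).
  apply: (D3_min e2M) Ds => g h; exists (iota g), (iota h).
  by rewrite (morph_R thetaM) !theta_iota; congr (_, _, _); exact: commg1.
have D3' : D3 (s, 1, s).
  apply: (D3_min e3M) Ds => g h; exists (phi g), (phi h).
  by rewrite (morph_R thetaM) !theta_phi; congr (_, _, _); exact: commg1.
have D1V := subgroupV D3_subgroup D1.
split=> //.
- rewrite (_ : (1, s, 1) = (s, 1, 1)^-1 * (s, s, 1) :> H * H * H).
    exact: (subgroupM D3_subgroup).
  by rewrite mul3E inv3E /= mulVg !invg1 !mul1g.
- rewrite (_ : (1, 1, s) = (s, 1, 1)^-1 * (s, 1, s) :> H * H * H).
    exact: (subgroupM D3_subgroup).
  by rewrite mul3E inv3E /= mulVg !invg1 !mul1g.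
Qed.

End NuStructure.

(** * Finite generation modulo the center *)

Definition axes (H : groupType) (S : set H) : set (H * H * H) :=
  (fun s => (s, 1, 1)) @` S `|` (fun s => (1, s, 1)) @` S
    `|` (fun s => (1, 1, s)) @` S.

Lemma gen_axes (H : groupType) (S : set H) (u : (H * H * H)%type) :
  gen S u.1.1 -> gen S u.1.2 -> gen S u.2 ->
  gen (axes S) u.
Proof.
have sS3 := gen_subgroup (axes S).
have gen_min3 (e : H -> H * H * H) : {morph e : x y / x * y} ->
    (forall s, S s -> axes S (e s)) -> forall s, gen S s -> gen (axes S) (e s).
  move=> eM eS; apply: (gen_min (preimage_subgroup eM sS3)) => s /eS.
  exact: mem_gen.
case: u => [[a b] c] /= Sa Sb Sc.
rewrite (_ : (a, b, c) = (a, 1, 1) * (1, b, 1) * (1, 1, c) :> H * H * H).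
  apply: (subgroupM sS3); first apply: (subgroupM sS3).
  - apply: (gen_min3 (fun s => (s, 1, 1))) Sa => [x y|s Ss].
      by rewrite mul3E /= mulg1.
    by left; left; exists s.
  - apply: (gen_min3 (fun s => (1, s, 1))) Sb => [x y|s Ss].
      by rewrite mul3E /= mulg1.
    by left; right; exists s.
  - apply: (gen_min3 (fun s => (1, 1, s))) Sc => [x y|s Ss].
      by rewrite mul3E /= mulg1.
    by right; exists s.
by rewrite !mul3E /= !mulg1 !mul1g.
Qed.

Theorem corollaryC (G : groupType) (hG : is_nu_group G)
  (hfin : finite_set (derived G)) : central_by_finite G.
Proof.
case: hG => H [[S finS HS]] [f [fD finj fsurj]].
have fM := @gmulfM _ _ f.
have fthM : {morph @theta H \o f : x y / x * y}.
  by move=> x y /=; rewrite fM thetaM.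
apply: (fg_mod_center_central_by_finite fthM
  (S := axes S)) => //.
- move=> x /ker_theta_central fxZ y; apply: finj; rewrite ?in_setT//.
  by rewrite !fM; exact: fxZ.
- by rewrite !finite_setU; do ![split]; exact: finite_image.
- have D3f u : (@theta H @` derived (nu H)) u -> range (@theta H \o f) u.
    by move=> [_ /fsurj[x _ <-] <-]; exists x.
  have SD s : S s -> derived H s by rewrite HS; exact: mem_gen.
  by move=> _ [[|]|] [s /SD/derived_theta[? ? ?] <-]; exact: D3f.
- move=> _ [x _ <-]; have /theta_derived[] := fD x I.
  by rewrite HS; exact: gen_axes.
Qed.
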